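(* Let $X$ be a real Banach space, let $f: X \to \mathbb{R}\cup\{+\infty\}$ be a proper convex function and let $\ell\geq 0$. Then the following four statements are equivalent: (i) $f$ is $\ell$-Lipschitz on $\operatorname{dom}f$; (a) $f$ is locally Lipschitz at every point of $\operatorname{dom}f$ with the same modulus $\ell$; (b) $f$ is calm at every point of $\operatorname{dom}f$ with the same modulus $\ell$; (c) $\partial f(x)\cap\ell\mathbb{B}^*\neq\emptyset$ for all $x\in \operatorname{dom}f$.
   Context: $X^*$ is the continuous dual of $X$ with its dual norm, $\mathbb{B}^*$ is the closed unit ball of $X^*$ (so $\ell\mathbb{B}^*=\{x^*\in X^*:\|x^*\|\le \ell\}$), and $B(x;r)=\{y\in X:\|x-y\|<r\}$. For $f:X\to\mathbb{R}\cup\{+\infty\}$, $\operatorname{dom}f=\{x\in X: f(x)\in\mathbb{R}\}$; $f$ is proper if $\operatorname{dom} f\neq\emptyset$, and convex if its epigraph $\{(x,r)\in X\times\mathbb{R}: f(x)\le r\}$ is convex. For a nonempty set $S\subset X$, $f$ is $\ell$-Lipschitz on $S$ if $f$ is finite on $S$ and $|f(x)-f(y)|\le \ell\|x-y\|$ for all $x,y\in S$. $f$ is locally Lipschitz at $u\in\operatorname{dom}f$ with modulus $\ell$ if there exists $r>0$ (depending on $u$) such that $f$ is $\ell$-Lipschitz on $\operatorname{dom}f\cap B(u;r)$. $f$ is calm at $u\in\operatorname{dom}f$ with modulus $\ell\ge 0$ if there is a neighborhood $V$ of $u$ in $X$ such that $f(x)\ge f(u)-\ell\|x-u\|$ for all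 $x\in V$. The subdifferential of $f$ at $x$ with $f(x)$ finite is $\partial f(x)=\{x^*\in X^*: f(y)-f(x)\ge\langle x^*,y-x\rangle\ \forall y\in X\}$. *)

(* Defs.v *)
From HB Require Import structures.
From mathcomp Require Import all_boot all_order all_algebra.
From mathcomp Require Import all_classical all_reals all_analysis.

Set Implicit Arguments.
Unset Strict Implicit.
Unset Printing Implicit Defensive.

Import Order.TTheory GRing.Theory Num.Theory.
Import numFieldNormedType.Exports.

Local Open Scope classical_set_scope.
Local Open Scope ring_scope.

Section ContinuousDual.
Context {R : realType} (X : normedModType R).

Record dual := Dual {
  dual_fun :> {linear X -> R^o};
  dual_continuous : continuous dual_fun }.

(* The set is nonempty and, by continuity of phi, bounded above, so the real
   supremum sup takes its genuine value here. *)
Definition dual_norm (phi : dual) : R :=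
  sup [set `|phi x| | x in [set x : X | `|x| <= 1]].

Definition dual_cball (ell : R) : set dual :=
  [set phi | dual_norm phi <= ell].

End ContinuousDual.

Arguments dual_cball {R} X ell.

(* A function X -> R \cup {+oo} is represented by f : X -> \bar R that never
   takes the value -oo, which is a hypothesis of its own and not part of the
   definitions below. *)
Section ExtendedRealFunctions.
Context {R : realType} {X : normedModType R}.
Implicit Types (f : X -> \bar R) (S : set X) (ell : R) (u x : X).

Definition edom f : set X := [set x | f x \is a fin_num].

Definition eproper f := edom f !=set0.

Definition epigraph f : set (X * R^o) := [set p | (f p.1 <= p.2%:E)%E].

Definition econvex f := convex_set (epigraph f).

Definition elipschitz_on ell f S :=
  S `<=` edom f /\ ell.-lipschitz_S (fun x => fine (f x) : R^o).

Definition locally_lipschitz_at ell f u :=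
  exists2 r : R, 0 < r & elipschitz_on ell f (edom f `&` ball u r).

Definition calm_at ell f u :=
  \forall x \near u, (f u - (ell * `|x - u|)%:E <= f x)%E.

(* Meaningful for x in edom f only. *)
Definition subdifferential f x : set (dual X) :=
  [set phi | forall y, ((phi (y - x))%:E <= f y - f x)%E].

End ExtendedRealFunctions.

(* Main.v *)
Require Import Defs.
From HB Require Import structures.
From mathcomp Require Import all_boot all_order all_algebra.
From mathcomp Require Import all_classical all_reals all_analysis.
From mathcomp Require Import ring lra.

Set Implicit Arguments.
Unset Strict Implicit.
Unset Printing Implicit Defensive.

Import Order.TTheory GRing.Theory Num.Theory.
Import numFieldNormedType.Exports.

Local Open Scope classical_set_scope.
Local Open Scope ring_scope.

(** Restricting a Lipschitz estimate gives a local one, a local one at u gives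
    calmness at u (where f is +oo there is nothing to prove), and two
    subgradients of norm at most ell, one at each of two points of the domain,
    bound the increment of f between these points in both directions.  The
    substance is that calmness produces a small subgradient.

    Let f be calm at x.  Convexity along the segment from x to y turns the
    local bound into the global one f y - f x >= - ell * |y - x|
    (calm_global).  So the sublinear function p = ell * |.| and the convex cone
    generated by the shifted epigraph epi f - (x, f x) satisfy
    p (- w) + a >= 0 for every (w, a) in the cone.  The Hahn-Banach theorem in
    the form hahn_banach_cone then yields a linear phi with phi <= p everywhere
    and phi w <= a on the cone: the first property says that phi is continuous
    of norm at most ell, the second that it is a subgradient of f at x.

    The Hahn-Banach theorem is obtained without extending functionals from
    subspaces.  Given a sublinear q and a compatible cone K, the function
    tighten q K, v |-> inf_((w, a) in K) (q (v - w) + a), is the largest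
    sublinear function below q that is at most a at w for all (w, a) in K.  By
    Zorn there is a minimal sublinear function below tighten p K, and minimal
    sublinear functions are linear: tightening one of them, q, along the ray
    spanned by (- u, - q u) cannot lower it, and this says that
    q u + q v <= q (u + v). *)

(** * A Hahn-Banach theorem for convex cones *)

Section Sublinear.
Context {R : realType} {V : lmodType R}.
Implicit Types (p q : V -> R) (K : set (V * R)) (u v : V).

(** Asking for the inequality at positive t only is enough: applied to the
    inverse of t, it gives equality. *)
Definition sublinear q :=
  (forall u v, q (u + v) <= q u + q v) /\
  (forall t v, 0 < t -> q (t *: v) <= t * q v).

Lemma sublinear0 q : sublinear q -> q 0 = 0.
Proof.
move=> [qD qZ].
have := qD 0 0; rewrite addr0.
have := qZ 2^-1 0; rewrite scaler0 invr_gt0 ltr0n => /(_ isT).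
lra.
Qed.

Lemma sublinearN_ge q v : sublinear q -> - q (- v) <= q v.
Proof.
move=> sq; have [qD _] := sq.
have := qD v (- v); rewrite subrr sublinear0//; lra.
Qed.

Lemma sublinearZ q t v : sublinear q -> 0 < t -> q (t *: v) = t * q v.
Proof.
move=> [_ qZ] t0; apply/le_anti; rewrite qZ//=.
rewrite -ler_pdivlMl//.
by have := qZ t^-1 (t *: v); rewrite invr_gt0 scalerK ?gt_eqF//; exact.
Qed.

Definition convex_cone K :=
  [/\ K (0, 0),
      forall u v a b, K (u, a) -> K (v, b) -> K (u + v, a + b) &
      forall t v a, 0 < t -> K (v, a) -> K (t *: v, t * a)].

(** The infimal convolution of q with the function whose epigraph is
    generated by K. *)
Definition tighten q K v : R := inf [set q (v - k.1) + k.2 | k in K].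

Section Tighten.
Variables (q : V -> R) (K : set (V * R)).
Hypotheses (sq : sublinear q) (cK : convex_cone K).
Hypothesis qK : forall v a, K (v, a) -> 0 <= q (- v) + a.

(** The hypothesis qK bounds the infimum below by - q (- v), so that it is a
    true one. *)
Lemma tighten_le v w a : K (w, a) -> tighten q K v <= q (v - w) + a.
Proof.
move=> Kwa; apply: ge_inf; last by exists (w, a).
exists (- q (- v)) => _ /= [[w' b] Kwb <-] /=.
have := qK Kwb; have [qD _] := sq.
have := qD (v - w') (- v); rewrite addrAC subrr sub0r; lra.
Qed.

Lemma tighten_ge v c :
  (forall w a, K (w, a) -> c <= q (v - w) + a) -> c <= tighten q K v.
Proof.
move=> H; apply: lb_le_inf => [|_ /= [[w a] Kwa <-]]; last exact: H.
by have [K0 _ _] := cK; exists (q (v - 0) + 0), (0, 0).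
Qed.

Lemma tighten_le_self v : tighten q K v <= q v.
Proof. by have [/(tighten_le v)] := cK; rewrite subr0 addr0. Qed.

Lemma tighten_le_cone v a : K (v, a) -> tighten q K v <= a.
Proof. by move=> /(tighten_le v); rewrite subrr sublinear0// add0r. Qed.

Lemma tighten_sublinear : sublinear (tighten q K).
Proof.
have [K0 KD KZ] := cK; have [qD qZ] := sq.
split=> [u v|t v t0].
  rewrite -lerBlDr; apply: tighten_ge => w a Kwa.
  rewrite lerBlDr -lerBlDl; apply: tighten_ge => w' b Kwb.
  rewrite lerBlDl; apply: le_trans (tighten_le _ (KD _ _ _ _ Kwa Kwb)) _.
  have := qD (u - w) (v - w'); rewrite addrACA -opprD; lra.
rewrite -ler_pdivrMl//; apply: tighten_ge => w a Kwa.
rewrite ler_pdivrMl// mulrDr -sublinearZ// scalerBr.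
exact/tighten_le/KZ.
Qed.

End Tighten.

(** Zorn's lemma applies because a chain of sublinear functions below p is
    bounded below, by v |-> - p (- v), and its pointwise infimum is again
    sublinear. *)
Lemma minimal_sublinear p : sublinear p ->
  exists q, [/\ sublinear q, forall v, q v <= p v &
    forall q', sublinear q' -> (forall v, q' v <= q v) ->
      forall v, q v <= q' v].
Proof.
move=> sp.
pose T := {q : V -> R | sublinear q /\ forall v, q v <= p v}.
pose below (s t : T) := `[< forall v, sval t v <= sval s v >].
pose p0 : T := exist _ p (conj sp (fun v => lexx (p v))).
have lbT (s : T) v : - p (- v) <= sval s v.
  case: s => q [sq qp] /=; have := sublinearN_ge v sq.
  have := qp (- v); lra.
have [||A Atot|[q [sq qp]] qmin] := @ZL_preorder T p0 below.
- by move=> t; apply/asboolP => v.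
- move=> r s t /asboolP rs /asboolP st; apply/asboolP => v.
  exact: le_trans (st v) (rs v).
- have [[s0 As0]|A0] := pselect (A !=set0); last first.
    by exists p0 => s As; exfalso; apply: A0; exists s.
  pose m v := inf [set sval s v | s in A].
  have m_le s v : A s -> m v <= sval s v.
    move=> As; apply: ge_inf; last by exists s.
    by exists (- p (- v)) => _ /= [t _ <-].
  have m_ge v c : (forall s, A s -> c <= sval s v) -> c <= m v.
    move=> H; apply: lb_le_inf => [|_ /= [s As <-]]; last exact: H.
    by exists (sval s0 v), s0.
  have sm : sublinear m.
    split=> [u v|t v t0].
      rewrite -lerBlDr; apply: (m_ge) => s As.
      rewrite lerBlDr -lerBlDl; apply: (m_ge) => s' As'.
      rewrite lerBlDl.
      (* The smaller of s and s' is below the other one both at u and at v. *)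
      have [/asboolP le|/asboolP le] := Atot _ _ As As'.
        have [[sD _] _] := svalP s'.
        apply: le_trans (m_le _ _ As') _.
        by have := sD u v; have := le u; lra.
      have [[sD _] _] := svalP s.
      apply: le_trans (m_le _ _ As) _.
      by have := sD u v; have := le v; lra.
    rewrite -ler_pdivrMl//; apply: (m_ge) => s As.
    rewrite ler_pdivrMl//; have [[_ sZ] _] := svalP s.
    exact: le_trans (m_le _ _ As) (sZ _ _ t0).
  have mp v : m v <= p v.
    by have [_ s0p] := svalP s0; exact: le_trans (m_le _ _ As0) (s0p v).
  by exists (exist _ m (conj sm mp)) => s As; apply/asboolP => v; exact: m_le.
exists q; split=> // q' sq' q'q.
have q'p v : q' v <= p v by exact: le_trans (q'q v) (qp v).
have /(_ _)/asboolP := qmin (exist _ q' (conj sq' q'p)).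
by apply; apply/asboolP.
Qed.

(** Tightening q along the ray of (- u, - q u) gives a sublinear function which
    at v is at most q (v + u) - q u; by minimality so is q v.  Hence q is
    additive, therefore odd, and homogeneous for scalars of every sign. *)
Lemma minimal_sublinear_linear q : sublinear q ->
  (forall q', sublinear q' -> (forall v, q' v <= q v) ->
     forall v, q v <= q' v) ->
  linear (q : V -> R^o).
Proof.
move=> sq qmin.
have qD u v : q (u + v) = q u + q v.
  apply/le_anti; have [-> _ /=] := sq.
  pose K : set (V * R) :=
    [set k | exists2 t, 0 <= t & k = (- (t *: u), - (t * q u))].
  have cK : convex_cone K.
    split.
    - by exists 0 => //; rewrite scale0r mul0r !oppr0.
    - move=> _ _ _ _ [s s0 [-> ->]] [t t0 [-> ->]].
      by exists (s + t); rewrite ?addr_ge0// scalerDl mulrDl !opprD.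
    - move=> t _ _ t0 [s s0 [-> ->]].
      exists (t * s); first by rewrite mulr_ge0// ltW.
      by rewrite scalerN scalerA mulrN mulrA.
  have qK w a : K (w, a) -> 0 <= q (- w) + a.
    move=> [t + [-> ->]]; rewrite opprK le_eqVlt => /predU1P[<-|t0].
      by rewrite scale0r mul0r sublinear0// subr0.
    by rewrite sublinearZ// subrr.
  have := qmin _ (tighten_sublinear sq cK qK) (tighten_le_self sq cK qK) v.
  move=> /le_trans qle.
  have Ku : K (- u, - q u) by exists 1; rewrite ?scale1r ?mul1r.
  by have := tighten_le sq qK v Ku; rewrite opprK [v + u]addrC => /qle; lra.
have qN v : q (- v) = - q v.
  by have := qD v (- v); rewrite subrr sublinear0//; lra.
move=> t u v; rewrite qD; congr (_ + _).
have [t0|t0|->] := ltgtP t 0.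
- by rewrite -[t]opprK scaleNr qN sublinearZ ?oppr_gt0// -mulNr.
- exact: sublinearZ.
- by rewrite scale0r sublinear0// scale0r.
Qed.

End Sublinear.

(** The classical dominated extension theorem is the case where K is the graph
    of a linear functional on a subspace; a cone allows convex constraints. *)
Lemma hahn_banach_cone {R : realType} {V : lmodType R} (p : V -> R)
    (K : set (V * R)) :
  sublinear p -> convex_cone K ->
  (forall v a, K (v, a) -> 0 <= p (- v) + a) ->
  exists phi : {linear V -> R^o},
    (forall v, phi v <= p v) /\ (forall v a, K (v, a) -> phi v <= a).
Proof.
move=> sp cK pK.
have [q [sq qle qmin]] := minimal_sublinear (tighten_sublinear sp cK pK).
have lq := minimal_sublinear_linear sq qmin.
pose phi : {linear V -> R^o} :=
  HB.pack (q : V -> R^o) (GRing.isLinear.Build R V R^o *:%R q lq).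
exists phi; split=> [v|v a Kva].
  exact: (le_trans (qle v) (tighten_le_self sp cK pK v)).
exact: (le_trans (qle v) (tighten_le_cone sp pK Kva)).
Qed.

(** * The dual norm *)

Section Dual.
Context {R : realType} {X : normedModType R}.
Implicit Types (phi : dual X) (ell : R) (v : X).

(** Continuity makes the set defining the dual norm bounded above; without that
    the supremum would be a default value. *)
Lemma dual_norm_bound phi v : `|phi v| <= dual_norm phi * `|v|.
Proof.
have [->|v0] := eqVneq v 0; first by rewrite linear0 !normr0 mulr0.
have /linear_boundedP/pinfty_ex_gt0[M M0 HM] : bounded_near phi (nbhs (0 : X)).
  by apply/linear_bounded_continuous; exact: dual_continuous.
have nv0 : 0 < `|v| by rewrite normr_gt0.
rewrite -ler_pdivrMr//; apply: ub_le_sup.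
  exists M => _ /= [w w1 <-]; apply: le_trans (HM w) _.
  by rewrite ler_piMr// ltW.
exists (`|v|^-1 *: v) => /=.
  by rewrite normrZ normfV normr_id mulVf ?gt_eqF.
by rewrite linearZ normrZ normfV normr_id mulrC.
Qed.

Lemma dual_of_bounded ell (phi : {linear X -> R^o}) : 0 <= ell ->
  (forall v, phi v <= ell * `|v|) ->
  exists2 psi : dual X, dual_cball X ell psi & forall v, psi v = phi v.
Proof.
move=> ell0 le_phi.
have abs_phi v : `|phi v| <= ell * `|v|.
  by rewrite ler_norml le_phi andbT lerNl -linearN -[`|v|]normrN.
have cphi : continuous phi.
  apply/linear_bounded_continuous/linear_boundedP.
  near=> M => v; apply: le_trans (abs_phi v) _.
  by rewrite ler_wpM2r//; near: M; exact: nbhs_pinfty_ge.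
exists (Dual cphi) => //=; apply: ge_sup.
  by exists `|phi 0|, 0 => //=; rewrite normr0.
by move=> _ /= [v v1 <-]; apply: le_trans (abs_phi v) _; rewrite ler_piMr.
Unshelve. all: by end_near. Qed.

End Dual.

(** * Subgradients of convex functions at calm points *)

Section Convex.
Context {R : realType} {X : normedModType R}.
Variable f : X -> \bar R.
Hypothesis f_convex : econvex f.
Implicit Types (ell r s t : R) (x y z : X).

Lemma econvex_le x y r s t : 0 <= t -> t <= 1 ->
  (f x <= r%:E)%E -> (f y <= s%:E)%E ->
  (f (t *: x + (1 - t) *: y)%R <= (t * r + (1 - t) * s)%:E)%E.
Proof.
move=> t0 t1 fx fy.
have := @f_convex (x, r : R^o) (y, s : R^o) (Itv01 t0 t1).
by rewrite !inE; exact.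
Qed.

(** For small t > 0 the point t y + (1 - t) x lies where calmness applies, and
    convexity bounds f there by t r + (1 - t) f x; dividing by t gives the bound
    at y. *)
Lemma calm_global ell x : edom f x -> calm_at ell f x ->
  forall y r, (f y <= r%:E)%E -> 0 <= ell * `|y - x| + (r - fine (f x)).
Proof.
move=> fx calm y r fy.
have cvg_seg : (fun t : R => t *: y + (1 - t) *: x) t @[t --> 0^'+] --> x.
  apply: cvg_at_right_filter.
  rewrite -[X in _ --> X](_ : 0 *: y + (1 - 0) *: x = x); last first.
    by rewrite scale0r add0r subr0 scale1r.
  apply: cvgD; apply: cvgZr_tmp; first exact: cvg_id.
  by apply: cvgB; [exact: cvg_cst|exact: cvg_id].
have [t [t0 t1]] : exists t : R, [/\ 0 < t, t <= 1 &
    (f x - (ell * `|t *: y + (1 - t) *: x - x|)%:E <=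
     f (t *: y + (1 - t) *: x)%R)%E].
  near (0 : R)^'+ => t; exists t; split; near: t.
  - exact: nbhs_right_gt.
  - exact: nbhs_right_le.
  - exact: cvg_seg _ calm.
have -> : t *: y + (1 - t) *: x - x = t *: (y - x).
  by rewrite scalerBl scale1r scalerBr addrA addrAC addrK.
rewrite normrZ gtr0_norm// => le_lo.
have fxE : (f x <= (fine (f x))%:E)%E by rewrite fineK.
have := le_trans le_lo (econvex_le (ltW t0) t1 fy fxE).
rewrite -[in f x](fineK fx) -EFinB lee_fin => H.
rewrite -(pmulr_rge0 _ t0); lra.
Unshelve. all: by end_near. Qed.

(** The convex cone generated by epi f - (x, f x). *)
Definition epi_cone x : set (X * R) :=
  [set k | exists t y r, [/\ 0 <= t, (f y <= r%:E)%E &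
    k = (t *: (y - x), t * (r - fine (f x)))]].

(** A positive combination t (y - x) + u (z - x) is t + u times the difference
    between a convex combination of y and z and the point x. *)
Lemma epi_cone_convex x : edom f x -> convex_cone (epi_cone x).
Proof.
move=> fx; split.
- exists 0, x, (fine (f x)); split=> //; first by rewrite fineK.
  by rewrite scale0r mul0r.
- move=> _ _ _ _ [t [y [r [t0 fy [-> ->]]]]] [u [z [s [u0 fz [-> ->]]]]].
  (* Both scalars may vanish, in which case t / (t + u) is meaningless. *)
  have [tu0|tu0] := eqVneq (t + u) 0.
    have [-> ->] : t = 0 /\ u = 0 by split; lra.
    by exists 0, y, r; rewrite !scale0r !mul0r !addr0.
  have tu_gt0 : 0 < t + u by rewrite lt_neqAle eq_sym tu0 addr_ge0.
  have cE : 1 - t / (t + u) = u / (t + u) by field.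
  pose c := t / (t + u).
  exists (t + u), (c *: y + (1 - c) *: z), (c * r + (1 - c) * s); split.
  + exact: ltW.
  + apply: econvex_le => //; first by rewrite divr_ge0// ltW.
    by rewrite ler_pdivrMr// mul1r lerDl.
  + congr (_, _).
      rewrite cE [RHS]scalerBr [X in _ = X - _]scalerDr !scalerA.
      rewrite ![(t + u) * _]mulrC !divfK//.
      by rewrite scalerDl !scalerBr opprD addrACA.
    by rewrite cE /c; field.
- move=> u _ _ u0 [t [y [r [t0 fy [-> ->]]]]].
  by exists (u * t), y, r; rewrite mulr_ge0 ?(ltW u0)// scalerA mulrA.
Qed.

(** The separating functional lies below ell * |.| and, evaluated at the
    generators of the cone with t = 1, below the increments of f from x. *)
Lemma calm_subgradient ell x : 0 <= ell -> (forall y, f y != -oo%E) ->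
  edom f x -> calm_at ell f x ->
  subdifferential f x `&` dual_cball X ell !=set0.
Proof.
move=> ell0 fNy fx calm.
have [||phi [phi_le phi_epi]] :=
    hahn_banach_cone (p := fun v : X => ell * `|v|) _ (epi_cone_convex fx).
- split=> [u v|t v t0]; first by rewrite -mulrDr ler_wpM2l// ler_normD.
  by rewrite normrZ gtr0_norm// mulrCA.
- move=> _ _ [t [y [r [t0 fy [-> ->]]]]].
  rewrite normrN normrZ ger0_norm// mulrCA -mulrDr mulr_ge0//.
  exact: calm_global.
have [psi psi_ball psiE] := dual_of_bounded ell0 phi_le.
exists psi; split=> // y; rewrite psiE -[f x]fineK//.
case fyE : (f y) => [r| |]; last by have := fNy y; rewrite fyE.
  rewrite -EFinB lee_fin; apply: phi_epi.
  by exists 1, y, r; rewrite fyE scale1r mul1r.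
by rewrite addye// leey.
Qed.

End Convex.

Theorem corollary3p1 (R : realType) (X : completeNormedModType R)
    (f : X -> \bar R) (ell : R)
    (f_gt_ninfty : forall x, f x != -oo%E)
    (f_proper : eproper f) (f_convex : econvex f) (ell_ge0 : 0 <= ell) :
  [<-> elipschitz_on ell f (edom f);
       forall u, edom f u -> locally_lipschitz_at ell f u;
       forall u, edom f u -> calm_at ell f u;
       forall x, edom f x ->
         subdifferential f x `&` dual_cball X ell !=set0].
Proof.
tfae.
- move=> [_ lip] u fu; exists 1 => //; split=> [x []//|].
  by move=> [x y] /= [[fx _] [fy _]]; exact: (lip (x, y)).
- move=> loc u fu; have [r r0 [_ lip]] := loc u fu.
  apply/nbhs_ballP; exists r => //= x ux.
  case fxE : (f x) => [s| |]; last by have := f_gt_ninfty x; rewrite fxE.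
    have /= := lip (x, u); rewrite fxE/= -[in f u](fineK fu) -EFinB lee_fin.
    have fx : edom f x by rewrite /edom/= fxE.
    move=> /(_ (conj (conj fx ux) (conj fu (ballxx u r0)))).
    by rewrite ler_norml => /andP[+ _]; lra.
  by rewrite leey.
- by move=> calm x fx; apply: calm_subgradient => //; exact: calm.
- move=> sub; split=> //.
  suff le_lip x y : edom f x -> edom f y ->
      fine (f x) - fine (f y) <= ell * `|x - y|.
    move=> [x y] /= [fx fy]; rewrite ler_norml lerNl opprB.
    by rewrite le_lip// distrC le_lip.
  move=> fx fy; have [phi [/(_ y) phi_sub phi_ball]] := sub x fx.
  move: phi_sub; rewrite -(fineK fx) -(fineK fy) -EFinB lee_fin.
  rewrite -[y - x]opprB linearN => /= phi_sub.
  have := dual_norm_bound phi (x - y).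
  have : dual_norm phi * `|x - y| <= ell * `|x - y| by rewrite ler_wpM2r.
  by have := ler_norm (phi (x - y)); lra.
Qed.
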